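(* Assume that $\mathfrak{d}=\aleph_1$. Then the following relations hold between classes of topological spaces: $$\text{Lindelöf}^{\times}\ \subseteq\ (\text{Menger},\text{Lindelöf})^{\times}\ =\ \text{Menger}^{\times}\ \subseteq\ \text{Hurewicz}^{\times}.$$ That is: every productively Lindelöf space $X$ has the property that $X\times Y$ is Lindelöf for every Menger space $Y$; a space $X$ has the property that $X\times Y$ is Lindelöf for every Menger space $Y$ if and only if $X$ is productively Menger; and every productively Menger space is productively Hurewicz.
   Context: ''Space'' means an arbitrary topological space (no separation axioms assumed). A space $X$ is Menger if for each sequence $\mathcal{U}_1,\mathcal{U}_2,\dots$ of open covers of $X$ there are finite sets $\mathcal{F}_1\subseteq\mathcal{U}_1,\mathcal{F}_2\subseteq\mathcal{U}_2,\dots$ such that for every $x\in X$ the set $\{n\in\mathbb{N}: x\in\bigcup\mathcal{F}_n\}$ is infinite. It is Hurewicz if, in the same definition, the set $\{n\in\mathbb{N}: x\in\bigcup\mathcal{F}_n\}$ is required to be cofinite for every $x\in X$. Lindelöf means that every open cover has a countable subcover. For properties $\mathbf{P},\mathbf{Q}$ of spaces, $(\mathbf{P},\mathbf{Q})^{\times}$ is the class of all spaces $X$ such that for each space $Y$ with property $\mathbf{P}$, the product space $X\times Y$ has property $\mathbf{Q}$. Put $\mathbf{P}^{\times}:=(\mathbf{P},\mathbf{P})^{\times}$; a space in $\mathbf{P}^{\times}$ is called productively $\mathbf{P}$. $\mathfrak{d}$ is the dominating number: let $[\mathbb{N}]^{\infty}$ be the set of infinite subsets of $\mathbb{N}$,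 where each $a\in[\mathbb{N}]^\infty$ is identified with its increasing enumeration $n\mapsto a(n)$; $\mathfrak{d}$ is the minimal cardinality of a set $A\subseteq[\mathbb{N}]^\infty$ for which there is no $b\in[\mathbb{N}]^\infty$ such that for all $a\in A$, $a(n)\le b(n)$ for infinitely many $n$. *)

(* Defs.v *)
From HB Require Import structures.
From mathcomp Require Import all_boot all_order.
From mathcomp Require Import mathcomp_extra boolp classical_sets functions.
From mathcomp Require Import cardinality filter topology.

Set Implicit Arguments.
Unset Strict Implicit.
Unset Printing Implicit Defensive.

Local Open Scope classical_set_scope.
Local Open Scope card_scope.

Definition open_cover (X : topologicalType) (U : set (set X)) : Prop :=
  U `<=` open /\ \bigcup_(V in U) V = [set: X].

Definition lindelof (X : topologicalType) : Prop :=
  forall U : set (set X), open_cover U ->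
    exists V : set (set X), [/\ V `<=` U, countable V & open_cover V].

Definition menger (X : topologicalType) : Prop :=
  forall U : nat -> set (set X), (forall n, open_cover (U n)) ->
    exists F : nat -> set (set X),
      (forall n, F n `<=` U n /\ finite_set (F n)) /\
      (forall x : X, infinite_set [set n | (\bigcup_(V in F n) V) x]).

Definition hurewicz (X : topologicalType) : Prop :=
  forall U : nat -> set (set X), (forall n, open_cover (U n)) ->
    exists F : nat -> set (set X),
      (forall n, F n `<=` U n /\ finite_set (F n)) /\
      (forall x : X, cofinite_set [set n | (\bigcup_(V in F n) V) x]).

(* [prod_class P Q] is the class (P, Q)^x. *)
Definition prod_class (P Q : topologicalType -> Prop) (X : topologicalType) :
    Prop :=
  forall Y : topologicalType, P Y -> Q (X * Y)%type.

Definition productively (P : topologicalType -> Prop) : topologicalType -> Prop :=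
  prod_class P P.

(* The increasing enumeration of an infinite set [a] of natural numbers,
   indexed from 0; the value is irrelevant when [a] is finite. *)
Definition incr_enum (a : set nat) : nat -> nat :=
  xget (id : nat -> nat) [set f : nat -> nat | {homo f : m n / m < n} /\ range f = a].

Lemma incr_enum_subproof (a : set nat) : infinite_set a ->
  exists f : nat -> nat, {homo f : m n / m < n} /\ range f = a.
Proof.
move=> ainf.
have ex k : exists m, `[< a m /\ k <= m >].
  apply: contrapT => /forallNP H; apply: ainf.
  apply: (@sub_finite_set _ _ `I_k); last exact: finite_II.
  move=> m am /=; rewrite ltnNge; apply/negP => km.
  by apply: (H m); apply/asboolP.
pose nxt k := ex_minn (ex k).
have nxtP k : [/\ a (nxt k), k <= nxt k & forall m, a m -> k <= m -> nxt k <= m].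
  rewrite /nxt; case: ex_minnP => m /asboolP[am km] H; split=> // p ap kp.
  by apply: H; apply/asboolP.
pose f := fix f n := if n is p.+1 then nxt (f p).+1 else nxt 0.
have fS n : f n < f n.+1 by case: (nxtP (f n).+1).
have fa n : a (f n) by case: n => [|n]; [case: (nxtP 0)|case: (nxtP (f n).+1)].
have fge n : n <= f n by elim: n => // n IH; exact: leq_ltn_trans IH (fS n).
exists f; split; first by apply: (homo_ltn ltn_trans).
apply/seteqP; split=> [_ [n _ <-]//|m am].
suff H n : m <= f n -> exists k, f k = m.
  by have [k <-] := H m (fge m); exists k.
elim: n => [|n IH] mf.
  exists 0; apply/eqP; rewrite eqn_leq mf andbT.
  by case: (nxtP 0) => _ _; apply.
have [/IH//|nm] := leqP m (f n).
exists n.+1; apply/eqP; rewrite eqn_leq mf andbT.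
by case: (nxtP (f n).+1) => _ _; apply.
Qed.

Lemma incr_enumP (a : set nat) : infinite_set a ->
  {homo incr_enum a : m n / m < n} /\ range (incr_enum a) = a.
Proof. by move=> /incr_enum_subproof /(xgetPex (id : nat -> nat)). Qed.

Definition dominating (A : set (set nat)) : Prop :=
  (forall a, A a -> infinite_set a) /\
  ~ (exists2 b : set nat, infinite_set b &
       forall a, A a -> infinite_set [set n | incr_enum a n <= incr_enum b n]).

(* [A] has cardinality aleph_1, the least uncountable cardinal. *)
Definition card_aleph1 (T : Type) (A : set T) : Prop :=
  ~ countable A /\
  forall (U : Type) (B : set U), ~ countable B -> A #<= B.

Definition dominating_number_eq_aleph1 : Prop :=
  exists D : set (set nat),
    [/\ dominating D,
        forall A : set (set nat), dominating A -> D #<= A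
      & card_aleph1 D].

(* Main.v *)
Require Import Defs.
From mathcomp Require Import all_boot all_order.
From mathcomp Require Import boolp classical_sets cardinality filter topology.
From HB Require Import structures.
From mathcomp Require Import functions wochoice.

(* Menger and Hurewicz are treated together as S-Menger, where S is a family of
   infinite sets of naturals, closed upwards modulo finite sets: the infinite
   sets for Menger, the cofinite sets for Hurewicz. The point is that if X * Y is Lindelof for all Menger Y, then X * Y
   is S-Menger for all S-Menger Y.

   As X * Y is Lindelof, a sequence of covers is described by a rank function
   f w n, the least index of a member of a countable subcover of the n-th cover
   containing w. If no g satisfies [n | f w n <= g n] in S for all w, take
   h : I -> nat -> nat with I uncountable such that each g is eventually bounded
   by h i for all but countably many i (from d = aleph_1), and points z i with
   [n | f (z i) n <= h i n] not in S. Add to Y * nat an isolated point p_i for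
   each i, letting p_i be close to (q, n) when (z i).2 is close to q and
   f (z i) n is large. This space is Menger: the S-Menger property of Y gives g
   such that f (z i) n < g n on a set of S whenever p_i is missed, and this
   happens for countably many i only. But its product with X contains the
   uncountable closed discrete set of the points ((z i).1, p_i). *)

Set Implicit Arguments.
Unset Strict Implicit.
Unset Printing Implicit Defensive.

Local Open Scope classical_set_scope.
Local Open Scope card_scope.

(** * Countable sets and eventual domination *)

Lemma injective_countable (T U : Type) (A : set T) (B : set U) (f : T -> U) :
  {in A &, injective f} -> (forall x, A x -> B (f x)) -> countable B ->
  countable A.
Proof.
move=> finj fAB /countable_injP[g ginj]; apply/countable_injP.
exists (g \o f) => x y xA yA /= /ginj fxy; apply: finj => //.
by apply: fxy; apply: mem_set; apply: fAB; exact: set_mem.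
Qed.

Lemma finite_bounded (T : Type) (A : set T) (p : T -> nat) :
  finite_set A -> exists m, forall x, A x -> p x <= m.
Proof.
move=> /(finite_image p)/finite_seqP[s sE].
exists (\max_(i <- s) i) => x Ax; apply: leq_bigmax_seq => //.
by have : (p @` A) (p x) by [exists x]; rewrite sE.
Qed.

Lemma finite_injective_le (T : Type) (A : set T) (f : T -> nat) (n : nat) :
  {in A &, injective f} -> finite_set [set x | A x /\ f x <= n].
Proof.
move=> finj; have [->|/set0P[x0 _]] := eqVneq [set x | A x /\ f x <= n] set0.
  exact: finite_set0.
apply: (@card_le_finite _ _ _ `I_n.+1) => //.
apply/pcard_leP/injfunPex; exists f; first by move=> x [].
by move=> x y /set_mem[Ax _] /set_mem[Ay _]; apply: finj; exact: mem_set.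
Qed.

(** Diagonalise along an injection [phi] into the naturals: [g n] bounds the finitely many [f x n]
    with [phi x <= n], so it can fail for [x] only at [n < phi x]. *)
Lemma countable_eventually_dominated (T : Type) (A : set T)
    (f : T -> nat -> nat) : countable A ->
  exists g : nat -> nat, forall x, A x -> finite_set [set n | g n < f x n].
Proof.
move=> /countable_injP[phi phi_inj].
have /choice[g gP] n : exists m, forall x, A x /\ phi x <= n -> f x n <= m.
  exact: finite_bounded (finite_injective_le n phi_inj).
exists g => x Ax; apply: (sub_finite_set _ (finite_II (phi x))) => n /=.
by rewrite !ltnNge; apply: contra => xn; exact: gP.
Qed.

(** * Rankings of a set of size aleph_1 *)

Lemma well_order_minimum (T : eqType) (R : rel T) (A : set T) (x : T) :
  well_order R -> A x -> exists2 m, A m & forall y, A y -> R m y.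
Proof.
move=> /(_ (mem A)) wo Ax; have [|m [[/set_mem Am mA] _]] := wo.
  by exists x; exact: mem_set.
by exists m => // y Ay; apply: mA; exact: mem_set.
Qed.

(* Pull back a well-order, restricted to its least uncountable initial segment
   of [D], along an injection of [D] into that segment. *)
Lemma aleph1_ranking (K : pointedType) (D : set K) : card_aleph1 D ->
  exists r : K -> K -> Prop,
    (forall a b, D a -> D b -> r a b \/ r b a) /\
    (forall a, D a -> countable [set b | D b /\ r b a]).
Proof.
move=> [Dunc Dmin]; have [R wo] := well_ordering_principle K.
have woT : wo_chain R [pred _ | true] by exact: withinW.
have Rtot x y : R x y \/ R y x.
  by apply/orP; apply: (wo_chainW woT).
pose seg a := [set b | D b /\ R b a].
have [[a0 [Da0 a0unc]]|/forallNP segC] :=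
    pselect (exists a, D a /\ ~ countable (seg a)); last first.
  exists R; split=> [a b _ _|a Da]; first exact: Rtot.
  by apply: contrapT => ?; apply: (segC a).
have [a [Da aunc] amin] := @well_order_minimum _ R
  [set a | D a /\ ~ countable (seg a)] a0 wo (conj Da0 a0unc).
(* Only points strictly below [a] are kept, so minimality of [a] makes their segments countable. *)
pose S := seg a `\ a.
have Sunc : ~ countable S.
  move=> Sc; apply: aunc.
  apply: (@sub_countable _ _ _ (\bigcup_n bigcup2 S [set a] n)).
    rewrite bigcup2E; apply: subset_card_le => b segb.
    by have [->|/eqP ba] := eqVneq b a; [right|left].
  apply: bigcup_countable => // -[|[|n]] _ //=; exact: finite_set_countable.
have SC c : S c -> countable (seg c).
  move=> [[Dc Rca] ca]; apply: contrapT => cunc; apply: ca.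
  have Rac : R a c by exact: amin.
  by apply: (wo_chain_antisymmetric woT) => //; rewrite Rca Rac.
have /pcard_leP/injfunPex[phi phiS phi_inj] := Dmin _ S Sunc.
exists (fun x y => R (phi x) (phi y)); split=> [x y _ _|x Dx].
  exact: Rtot.
apply: (@injective_countable _ _ _ (seg (phi x)) phi) => [y z|y [Dy Rxy]|].
- by move=> /set_mem[Dy _] /set_mem[Dz _]; apply: phi_inj; exact: mem_set.
- by split=> //; case: (phiS y Dy) => -[].
- exact/SC/phiS.
Qed.

(** * From a dominating family to a scale *)

Lemma homo_ltn_ge_id (f : nat -> nat) (n : nat) :
  {homo f : m n / m < n} -> n <= f n.
Proof. by move=> fI; elim: n => // n /leq_ltn_trans; apply; exact: fI. Qed.

Lemma infinite_range_homo (f : nat -> nat) :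
  {homo f : m n / m < n} -> infinite_set (range f).
Proof.
move=> fI /(finite_bounded id)[m mP].
have : f m.+1 <= m by apply: mP; exists m.+1.
by rewrite leqNgt (homo_ltn_ge_id m.+1 fI).
Qed.

(** The enumeration is [f] composed with a strictly increasing [k], and [n <= k n]. *)
Lemma le_incr_enum_range (f : nat -> nat) (n : nat) :
  {homo f : m n / m < n} -> f n <= incr_enum (range f) n.
Proof.
move=> fI; have [eI eR] := incr_enumP (infinite_range_homo fI).
have fM : {mono f : m n / m <= n} by exact: leq_mono.
have /choice[k kE] m : exists k, f k = incr_enum (range f) m.
  have : range f (incr_enum (range f) m) by rewrite -[X in X _]eR; exists m.
  by move=> [k _ <-]; exists k.
rewrite -kE fM; apply: homo_ltn_ge_id => i j ij.
by rewrite -(leqW_mono fM) !kE; exact: eI.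
Qed.

Lemma dominating_function (D : set (set nat)) (g : nat -> nat) :
  dominating D ->
  exists2 a, D a & finite_set [set n | incr_enum a n < g n].
Proof.
move=> [_ /forall2NP domD].
(* Only increasing enumerations can be compared with [D], so [g] is replaced by a strictly
   increasing function above it. *)
pose f n := \sum_(i < n.+1) (g i).+1.
have fI : {homo f : m n / m < n}.
  apply: homo_ltn => [? ? ?|n]; first exact: ltn_trans.
  by rewrite /f [X in _ < X]big_ord_recr /= addnS ltnS leq_addr.
have [//|/existsNP[a /not_implyP[Da /contrapT afin]]] := domD (range f).
  by move/(_ (infinite_range_homo fI)).
exists a => //; apply: sub_finite_set afin => n /= /ltnW /leq_trans; apply.
apply: (leq_trans _ (le_incr_enum_range n fI)).
by rewrite /f big_ord_recr /= addnS ltnW// ltnS leq_addl.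
Qed.

(** The index set is the dominating family itself, and [h b] eventually bounds the enumerations of
    all sets ranked below [b]. If that of [a] eventually bounds [g], so does [h b] whenever [r a b];
    any other [b] is among the countably many ranked below [a]. *)
Lemma aleph1_scale : dominating_number_eq_aleph1 ->
  exists (I : choiceType) (h : I -> nat -> nat), ~ countable [set: I] /\
    forall g, countable [set i | infinite_set [set n | h i n < g n]].
Proof.
move=> [D [Ddom _ Dal]]; have [r [rtot rc]] := aleph1_ranking Dal.
have /choice[h hP] (a : set_type D) : exists h : nat -> nat, forall b,
    D b /\ r b (val a) -> finite_set [set n | h n < incr_enum b n].
  by apply: countable_eventually_dominated; apply: rc; exact: set_valP.
exists (set_type D), h; split=> [Ic|g].
  case: Dal => + _; apply; apply: (sub_countable _ Ic).
  apply: card_le_trans (card_image_le val [set: set_type D]).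
  by apply: subset_card_le => a Da; exists (SigSub (mem_set Da)).
have [a Da ga] := dominating_function g Ddom.
apply: (@injective_countable _ _ _ [set b | D b /\ r b a] val); last exact: rc.
  by move=> x y _ _; exact: val_inj.
move=> b /= binf; split; first exact: set_valP.
have [//|rab] := rtot _ _ (set_valP b) Da.
exfalso; apply: binf.
have hab : finite_set [set n | h b n < incr_enum a n] by exact: hP.
apply: (@sub_finite_set _ _ ([set n | h b n < incr_enum a n] `|`
  [set n | incr_enum a n < g n])); last by rewrite finite_setU.
move=> n /= hg; have [ha|ah] := ltnP (h b n) (incr_enum a n); first by left.
by right; exact: leq_ltn_trans hg.
Qed.

(** * [S]-Menger spaces and selections *)

Definition smenger (S : set (set nat)) (X : topologicalType) : Prop :=
  forall U : nat -> set (set X), (forall n, open_cover (U n)) ->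
    exists F : nat -> set (set X),
      (forall n, F n `<=` U n /\ finite_set (F n)) /\
      (forall x : X, S [set n | (\bigcup_(V in F n) V) x]).

Definition semifilter (S : set (set nat)) : Prop :=
  (forall A, S A -> infinite_set A) /\
  (forall A B, S A -> finite_set (A `\` B) -> S B).

Lemma semifilter_infinite : semifilter [set A | infinite_set A].
Proof.
split=> // A B /= Ainf ABfin Bfin; apply: Ainf.
apply: (@sub_finite_set _ _ (A `\` B `|` B)); last by rewrite finite_setU.
by move=> n An; have [|] := pselect (B n); [right|left].
Qed.

Lemma semifilter_cofinite : semifilter [set A | cofinite_set A].
Proof.
split=> [A /=|A B /= Acof ABfin].
  by apply: cofinite_set_infinite; exact: infinite_nat.
apply: (@sub_finite_set _ _ (A `\` B `|` ~` A)); last by rewrite finite_setU.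
by move=> n Bn; have [|] := pselect (A n); [left|right].
Qed.

Lemma semifilterS (S : set (set nat)) (A B : set nat) :
  semifilter S -> A `<=` B -> S A -> S B.
Proof.
move=> [_ Sup] AB SA; apply: (Sup A) => //.
by move: AB; rewrite -setD_eq0 => ->.
Qed.

Lemma smenger_menger (S : set (set nat)) (X : topologicalType) :
  semifilter S -> smenger S X -> menger X.
Proof.
move=> [Sinf _] SX U /SX[F [FU FS]]; exists F; split=> // x; exact/Sinf/FS.
Qed.

Lemma menger_lindelof (X : topologicalType) : menger X -> lindelof X.
Proof.
move=> MX U Ucov; have [F [FU Finf]] := MX (fun=> U) (fun=> Ucov).
exists (\bigcup_n F n); split.
- by move=> V [n _] /(proj1 (FU n)).
- apply: bigcup_countable => // n _; apply: finite_set_countable.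
  exact: (FU n).2.
- split=> [V [n _] /(proj1 (FU n))|]; first exact: Ucov.1.
  rewrite -subTset => x _; have /infinite_setN0[n [V FV Vx]] := Finf x.
  by exists V => //; exists n.
Qed.

Lemma open_coverP (X : topologicalType) (U : set (set X)) (x : X) :
  open_cover U -> exists2 V, U V & V x.
Proof.
move=> [_ UT]; have : (\bigcup_(V in U) V) x by rewrite UT.
by move=> [V UV Vx]; exists V.
Qed.

(* Selection from families that need not consist of sets covering [Y]: it is
   enough that each point has a neighbourhood related to some member. *)
Lemma smenger_select (S : set (set nat)) (Y : topologicalType) (T : Type)
    (U : nat -> set T) (R : nat -> set Y -> T -> Prop) :
  semifilter S -> smenger S Y ->
  (forall n y, exists V t, [/\ open V, V y, U n t & R n V t]) ->
  exists F : nat -> set T, (forall n, F n `<=` U n /\ finite_set (F n)) /\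
    forall y, S [set n | exists V t, [/\ V y, F n t & R n V t]].
Proof.
move=> semiS SY UR.
pose W n := [set V : set Y | open V /\ exists2 t, U n t & R n V t].
have Wcov n : open_cover (W n).
  split=> [V []//|]; rewrite -subTset => y _.
  by have [V [t [? ? ? ?]]] := UR n y; exists V => //; split=> //; exists t.
have [G [GW GS]] := SY W Wcov.
have /choice[c cP] nV : exists C : set T,
    [/\ C `<=` U nV.1, finite_set C &
        W nV.1 nV.2 -> exists2 t, C t & R nV.1 nV.2 t].
  have [[_ [t Ut Rt]]|WN] := pselect (W nV.1 nV.2); last first.
    (* The empty family is the default, as [T] may have no element. *)
    by exists set0; split=> [t //| |/WN//]; exact: finite_set0.
  by exists [set t]; split=> [_ ->//| |_]; [exact: finite_set1|exists t].
exists (fun n => \bigcup_(V in G n) c (n, V)); split=> [n|y].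
  split=> [t [V _]|]; first by case: (cP (n, V)) => + _ _; apply.
  apply: bigcup_finite => [|V _]; first exact: (GW n).2.
  by case: (cP (n, V)).
apply: (semifilterS semiS _ (GS y)) => n [V GV Vy].
have [_ _ /(_ ((GW n).1 V GV))[t ct Rt]] := cP (n, V).
by exists V, t; split=> //; exists V.
Qed.

(** * Covering a space piece by piece *)

Definition coverable (T : topologicalType) (U : nat -> set (set T))
    (A : set T) : Prop :=
  exists F : nat -> set (set T),
    (forall n, F n `<=` U n /\ finite_set (F n)) /\
    (forall x, A x -> infinite_set [set n | (\bigcup_(V in F n) V) x]).

Lemma coverable1 (T : topologicalType) (U : nat -> set (set T)) (x : T) :
  (forall n, open_cover (U n)) -> coverable U [set x].
Proof.
move=> Ucov; have /choice[V VP] n : exists V, U n V /\ V x.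
  by have [V] := open_coverP x (Ucov n); exists V.
exists (fun n => [set V n]); split=> [n|_ ->].
  by split=> [_ ->|]; [case: (VP n)|exact: finite_set1].
rewrite (_ : [set n | _] = setT); first exact: infinite_nat.
by rewrite -subTset => n _ /=; exists (V n) => //; have [] := VP n.
Qed.

(* The finite families chosen for the first [n] sets are merged at stage [n]. *)
Lemma coverable_bigcup (T : topologicalType) (U : nat -> set (set T))
    (J : Type) (D : set J) (A : J -> set T) :
  countable D -> (forall j, D j -> coverable U (A j)) ->
  coverable U (\bigcup_(j in D) A j).
Proof.
move=> /countable_injP[phi phi_inj] Acov.
have /choice[F FP] j : exists F : nat -> set (set T), D j ->
    (forall n, F n `<=` U n /\ finite_set (F n)) /\
    (forall x, A j x -> infinite_set [set n | (\bigcup_(V in F n) V) x]).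
  have [/Acov[F FP]|] := pselect (D j); first by exists F.
  by exists (fun=> set0).
exists (fun n => \bigcup_(j in [set j | D j /\ phi j <= n]) F j n).
split=> [n|x [j Dj Ajx] fin].
  split=> [V [j [Dj _]]|]; first by case: (FP j Dj) => /(_ n)[+ _] _; apply.
  apply: bigcup_finite => [|j [Dj _]]; first exact: finite_injective_le.
  by case: (FP j Dj) => /(_ n)[].
have [_ /(_ x Ajx)] := FP j Dj; apply.
apply: (@sub_finite_set _ _ (`I_(phi j) `|` _)); last first.
  by rewrite finite_setU; split; [exact: finite_II|exact: fin].
move=> n [V FV Vx]; have [?|jn] := ltnP n (phi j); first by left.
by right; exists V => //; exists j.
Qed.

(** * Gluing isolated points to [Y * nat] *)

(** [y] and [f] are parameters of the type so that the topology instance can depend on them. *)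
Definition glued (Y : topologicalType) (I : choiceType) (y : I -> Y)
  (f : I -> nat -> nat) : Type := (Y * nat + I)%type.

Section GluedTopology.
Context (Y : topologicalType) (I : choiceType) (y : I -> Y).
Context (f : I -> nat -> nat).

Definition glued_nbhs (q : Y) (n : nat) (O : set (glued y f)) : Prop :=
  exists V k, [/\ open V, V q, forall q', V q' -> O (inl (q', n))
    & forall i, V (y i) -> k <= f i n -> O (inr i)].

Definition glued_open (O : set (glued y f)) : Prop :=
  forall q n, O (inl (q, n)) -> glued_nbhs q n O.

Lemma glued_nbhsS (q : Y) (n : nat) (O O' : set (glued y f)) :
  O `<=` O' -> glued_nbhs q n O -> glued_nbhs q n O'.
Proof.
move=> OO' [V [k [oV Vq VO fO]]]; exists V, k.
by split=> // [q' /VO /OO' //|i Vi ki]; apply: OO'; exact: fO.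
Qed.

Lemma glued_openT : glued_open setT.
Proof. by move=> q n _; exists setT, 0; split=> //; exact: openT. Qed.

Lemma glued_openI : setI_closed glued_open.
Proof.
move=> A B oA oB q n [/oA[V [k [oV Vq VA fA]]] /oB[W [l [oW Wq WB fB]]]].
exists (V `&` W), (maxn k l); split=> [|//|q' [Vq' Wq']|i [Vi Wi]].
- exact: openI.
- by split; [exact: VA|exact: WB].
- by rewrite geq_max => /andP[ki li]; split; [exact: fA|exact: fB].
Qed.

Lemma glued_open_bigcup (J : Type) (A : J -> set (glued y f)) :
  (forall j, glued_open (A j)) -> glued_open (\bigcup_j A j).
Proof.
by move=> oA q n [j _ /oA]; apply: glued_nbhsS => t Ajt; exists j.
Qed.

HB.instance Definition _ := Choice.on (glued y f).
HB.instance Definition _ := isOpenTopological.Build (glued y f)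
  glued_openT glued_openI glued_open_bigcup.

Lemma open_gluedE (O : set (glued y f)) : open O = glued_open O.
Proof. by []. Qed.

Lemma glued_isolated (i : I) : open [set inr i : glued y f].
Proof. by []. Qed.

End GluedTopology.

(** Countably many coverable pieces suffice: the copies of [Y], the countable set [L] of isolated
    points, and the remaining isolated points, caught by neighbourhoods of points of the copies. *)
Lemma glued_menger (S : set (set nat)) (Y : topologicalType) (I : choiceType)
    (y : I -> Y) (f : I -> nat -> nat) :
  semifilter S -> smenger S Y ->
  (forall g, countable [set i | S [set n | f i n < g n]]) ->
  menger (glued y f).
Proof.
move=> semiS SY fS U Ucov; have [Sinf Sup] := semiS.
have nbhsU m q n : exists V k O, [/\ open V, V q, U m O,
    forall q', V q' -> O (inl (q', n))
    & forall i, V (y i) -> k <= f i n -> O (inr i)].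
  have [O UO Oqn] := open_coverP (inl (q, n) : glued y f) (Ucov m).
  have [V [k [? ? ? ?]]] := (Ucov m).1 O UO q n Oqn.
  by exists V, k, O.
have Ycov n : coverable U [set inl (q, n) | q in [set: Y]].
  pose R (m : nat) V (O : set (glued y f)) := forall q, V q -> O (inl (q, n)).
  have [|F [FU FS]] := @smenger_select S Y _ U R semiS SY.
    by move=> m q; have [V [k [O []]]] := nbhsU m q n; exists V, O.
  exists F; split=> // _ [q _ <-]; apply: Sinf.
  apply: (semifilterS semiS _ (FS q)) => m [V [O [Vq FO VO]]].
  by exists O => //; exact: VO.
(* Stage [n] looks at the [n]-th copy of [Y]. Each chosen open set carries the threshold from which
   on it contains the nearby isolated points; [g n] will exceed these thresholds. *)
pose U' n := [set Ok : set (glued y f) * nat | U n Ok.1].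
pose R n (V : set Y) (Ok : set (glued y f) * nat) :=
  forall i, V (y i) -> Ok.2 <= f i n -> Ok.1 (inr i).
have [|F [FU FS]] := @smenger_select S Y _ U' R semiS SY.
  by move=> n q; have [V [k [O []]]] := nbhsU n q n; exists V, (O, k).
have /choice[g gP] n : exists m, forall Ok, F n Ok -> Ok.2 < m.
  have [m mP] := finite_bounded snd (FU n).2.
  by exists m.+1 => Ok /mP; rewrite ltnS.
pose L := [set i | S [set n | f i n < g n]].
have Lcov : coverable U (\bigcup_(i in L) [set inr i]).
  by apply: coverable_bigcup => [|i _]; [exact: fS|exact: coverable1].
have LCcov : coverable U [set inr i | i in ~` L].
  exists (fun n => fst @` F n); split=> [n|_ [i Li <-] covfin].
    split=> [_ [Ok /(FU n).1 UOk <-]//|].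
    by apply: finite_image; exact: (FU n).2.
  (* At each stage that selects a neighbourhood of [y i], either [f i n < g n] or the point is
     covered; being covered only finitely often would put [i] in [L]. *)
  apply: Li; apply: (Sup _ _ (FS (y i))); apply: sub_finite_set covfin.
  move=> n [[V [Ok [Vi FOk ROk]]] /negP]; rewrite -leqNgt => gf.
  exists Ok.1; first by exists Ok.
  by apply: ROk => //; apply: leq_trans gf; apply: ltnW; exact: gP.
pose A (j : nat) : set (glued y f) := match j with
  | 0 => \bigcup_(i in L) [set inr i] | 1 => [set inr i | i in ~` L]
  | n.+2 => [set inl (q, n) | q in [set: Y]] end.
have Acov j : coverable U (A j).
  by case: j => [|[|n]]; [exact: Lcov|exact: LCcov|exact: Ycov].
have [F' [FU' FT]] :=
  coverable_bigcup (card_lexx [set: nat]) (fun j _ => Acov j).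
exists F'; split=> // -[[q n]|i]; apply: FT.
  by exists n.+2 => //; exists q.
have [Li|Li] := pselect (L i); first by exists 0 => //; exists i.
by exists 1 => //; exists i.
Qed.

(** * Products with the glued space *)

Lemma open_setX (X Y : topologicalType) (A : set X) (B : set Y) :
  open A -> open B -> open (A `*` B).
Proof.
move=> oA oB; rewrite openE => -[a b] [/= Aa Bb].
exists (A, B) => //=; split; exact: open_nbhs_nbhs.
Qed.

(* Open sets meeting the diagonal [(z i).1, inr i] at most once cover the
   product, so a countable subcover forces the diagonal to be countable. *)
Lemma glued_lindelof_countable (X Y : topologicalType) (I : choiceType)
    (f : X * Y -> nat -> nat) (z : I -> X * Y) :
  (forall n k, open [set w | f w n <= k]) ->
  lindelof (X * glued (snd \o z) (f \o z))%type ->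
  countable [set: I].
Proof.
move=> fopen Lind; set G := glued _ _ in Lind *.
pose diag i : X * G := ((z i).1, inr i).
pose U := [set W : set (X * G) | open W /\
  forall i j, W (diag i) -> W (diag j) -> i = j].
have [|W [WU Wc Wcov]] := Lind U.
  split=> [W []//|]; rewrite -subTset => -[x [[q n]|i]] _; last first.
    exists (setT `*` [set inr i]) => //; split.
      by apply: open_setX; [exact: openT|exact: glued_isolated].
    by move=> j k [_ /= [->]] [_ /= [->]].
  have : nbhs (x, q) [set w | f w n <= f (x, q) n].
    by apply: open_nbhs_nbhs; split; [exact: fopen|exact: leqnn].
  move=> [[A0 B0] /= []].
  rewrite !nbhsE => -[A [oA Ax] AA0] [B [oB Bq] BB0] AB.
  (* On the box of [A] and [B] the [n]-th rank is at most [f (x, q) n], while [N] admits only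
     isolated points of larger rank; hence the box of [A] and [N] misses the diagonal. *)
  pose N : set G := [set t | match t with inl qn => B qn.1 /\ qn.2 = n
    | inr i => B (z i).2 /\ f (x, q) n < f (z i) n end].
  exists (A `*` N); last by [].
  split.
    apply: open_setX => //; rewrite open_gluedE => q' n' [/= Bq' ->].
    by exists B, (f (x, q) n).+1; split.
  move=> i j [/= Ai [Bi fi]]; exfalso; move: fi; rewrite ltnNge => /negP; apply.
  by apply: (AB (z i)); split; [exact: AA0|exact: BB0].
have /choice[w wP] i : exists V, W V /\ V (diag i).
  by have [V] := open_coverP (diag i) Wcov; exists V.
apply: (@injective_countable _ _ _ W w) => // [i j _ _ wij|i _]; last first.
  exact: (wP i).1.
have [Wi wi] := wP i; have [_ wj] := wP j; rewrite -wij in wj.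
by have [_] := WU _ Wi; apply.
Qed.

(** * Rank functions and the product theorem *)

(** The set where [f x n <= k] is the union of the finitely many members of index at most [k] in a
    countable subcover. *)
Lemma lindelof_cover_rank (X : topologicalType) (U : nat -> set (set X)) :
  lindelof X -> (forall n, open_cover (U n)) ->
  exists f : X -> nat -> nat, (forall n k, open [set x | f x n <= k]) /\
    forall n k, exists F, [/\ F `<=` U n, finite_set F
      & forall x, f x n <= k -> (\bigcup_(V in F) V) x].
Proof.
move=> LX Ucov.
have /choice[V VP] n := LX (U n) (Ucov n).
have /choice[phi phi_inj] n :
    exists phi : set X -> nat, {in V n &, injective phi}.
  by have [_ /countable_injP] := VP n.
have ex x n : exists m, `[< exists2 A, V n A & A x /\ phi n A = m >].
  have [_ _ /(open_coverP x)[A VA Ax]] := VP n.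
  by exists (phi n A); apply/asboolP; exists A.
pose f x n := ex_minn (ex x n).
have fP x n k : f x n <= k <-> exists2 A, V n A & A x /\ phi n A <= k.
  rewrite /f; case: ex_minnP => m /asboolP[A VA [Ax Am]] minm.
  split=> [mk|[B VB [Bx Bk]]]; first by exists A => //; rewrite Am.
  by apply: leq_trans Bk; apply: minm; apply/asboolP; exists B.
exists f; split=> n k.
  rewrite (_ : [set x | _] = \bigcup_(A in [set A | V n A /\ phi n A <= k]) A).
    by apply: bigcup_open => A [VA _]; have [_ _ [+ _]] := VP n; apply.
  apply/seteqP; split=> x.
    by move=> /fP[A VA [Ax Ak]]; exists A.
  by move=> [A [VA Ak] Ax]; apply/fP; exists A.
exists [set A | V n A /\ phi n A <= k]; split.
- by move=> A [VA _]; have [+ _ _] := VP n; apply.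
- exact: finite_injective_le.
- by move=> x /fP[A VA [Ax Ak]]; exists A.
Qed.

Lemma smenger_prod (S : set (set nat)) (X Y : topologicalType) :
  dominating_number_eq_aleph1 -> semifilter S ->
  prod_class menger lindelof X -> smenger S Y -> smenger S (X * Y)%type.
Proof.
move=> hd semiS XL SY U Ucov.
have [f [fopen fU]] :=
  lindelof_cover_rank (XL Y (smenger_menger semiS SY)) Ucov.
suff [g gS] : exists g : nat -> nat, forall w, S [set n | f w n <= g n].
  have /choice[F FP] n := fU n (g n).
  exists F; split=> [n|w]; first by have [] := FP n.
  apply: (semifilterS semiS _ (gS w)) => n /=.
  by have [_ _] := FP n; apply.
apply: contrapT => /forallNP nog.
have [I [h [Iunc hscale]]] := aleph1_scale hd; apply: Iunc.
have /choice[z zP] i : exists w, ~ S [set n | f w n <= h i n].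
  exact/existsNP.
apply: (glued_lindelof_countable (z := z) fopen); apply: XL.
apply: (glued_menger semiS SY) => g.
(* If [h i] eventually bounded [g], then [f (z i) n < g n <= h i n] would hold on a set in [S],
   against the choice of [z i]. *)
apply: (sub_countable _ (hscale g)); apply: subset_card_le => i /= Sg hfin.
apply: (zP i); apply: (semiS.2 _ _ Sg); apply: sub_finite_set hfin => n /=.
by move=> [fg /negP]; rewrite -ltnNge => hf; exact: ltn_trans fg.
Qed.

Theorem theorem3p13 (hd : dominating_number_eq_aleph1) :
  [/\ forall X : topologicalType,
        productively lindelof X -> prod_class menger lindelof X,
      forall X : topologicalType,
        prod_class menger lindelof X <-> productively menger X
    & forall X : topologicalType,
        productively menger X -> productively hurewicz X].
Proof.
have mengerL (X : topologicalType) :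
    prod_class menger lindelof X <-> productively menger X.
  split=> XM Y; first exact: (smenger_prod hd semifilter_infinite XM).
  by move=> /XM; exact: menger_lindelof.
split=> // X XP Y; first by move=> /menger_lindelof; exact: XP.
(* For the cofinite sets, [smenger] unfolds to [hurewicz]. *)
exact: (smenger_prod hd semifilter_cofinite (iffRL (mengerL X) XP)).
Qed.
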